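(* Let $\lambda>0$ and let $(a_1,a_2)$ be a commutative pair of random variables (i.e. $a_1a_2=a_2a_1$) in a non-commutative probability space $(\mathcal{A},\varphi)$. Then for every $n\in\mathbb{N}$ there is a sequence $\{(Z_{n,N,l},Z_{n,N,r}):N=1,2,\dots\}$ of pairs consisting of an $n\times n$ left matrix $Z_{n,N,l}$ and an $n\times n$ right matrix $Z_{n,N,r}$, with entries formed from creation and annihilation operators on a full Fock space, such that $Z_{n,N}=(Z_{n,N,l},Z_{n,N,r})$ converges in distribution, as $N\to\infty$, to the compound bi-free Poisson distribution determined by $\lambda$ and $\mu_{a_1,a_2}$, the distribution of the pair $(a_1,a_2)$. That is, $$\lim_{N\to\infty}\kappa_\chi(Z_{n,N,\chi(1)},\dots,Z_{n,N,\chi(m)})=\lambda\,\varphi(a_{\chi(1)}\cdots a_{\chi(m)})=\lambda\,\varphi\big(a_1^{|\chi^{-1}(\{l\})|}a_2^{|\chi^{-1}(\{r\})|}\big)$$ for all $m\ge1$ and $\chi:\{1,2,\dots,m\}\to\{l,r\}$, where $a_l:=a_1$ and $a_r:=a_2$.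
   Context: A non-commutative probability space $(\mathcal{A},\varphi)$ is a unital complex algebra with a unital linear functional. Full Fock space and left/right matrices. Let $\mathcal{H}$ be a complex Hilbert space, $\mathcal{X}=\mathcal{F}(\mathcal{H})=\mathbb{C}\Omega\oplus\bigoplus_{k\ge1}\mathcal{H}^{\otimes k}$ its full Fock space, and $p:\mathcal{X}\to\mathbb{C}$, $p(c\,\Omega+x_0)=c$ for $x_0\in\mathcal{X}^0=\bigoplus_{k\ge1}\mathcal{H}^{\otimes k}$. For $h\in\mathcal{H}$, the left and right creation operators are $l(h)\xi=h\otimes\xi$ and $r(h)\xi=\xi\otimes h$ (with $l(h)\Omega=r(h)\Omega=h$), and their adjoints are the left and right annihilation operators. ''Entries formed from creation and annihilation operators'' means entries in the unital algebra of operators on $\mathcal{F}(\mathcal{H})$ generated by the left and right creation and annihilation operators. Let $\mathcal{L}(\mathcal{X})$ denote the linear operators on $\mathcal{X}$, $\mathcal{X}_n=M_n(\mathcal{X})$ and $\mathcal{L}(\mathcal{X}_n)$ the linear operators on $\mathcal{X}_n$. For $T=[T_{i,j}]\in M_n(\mathcal{L}(\mathcal{X}))$, define the left matrix $L(T)$ and the right matrix $R(T)$ in $\mathcal{L}(\mathcal{X}_n)$ by $$L(T)[\eta_{i,j}]=\Big[\sum_{k=1}^nT_{i,k}(\eta_{k,j})\Big],\qquad R(T)[\eta_{i,j}]=\Big[\sum_{k=1}^nT_{k,j}(\eta_{i,k})\Big].$$ The distribution and bi-free cumulants of pairs in $\mathcal{L}(\mathcal{X}_n)$ are taken with respect to $\Phi=tr\circ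 E_{\mathcal{L}(\mathcal{X}_n)}$, where $E_{\mathcal{L}(\mathcal{X}_n)}(A)=[p((A1_{n,\Omega})_{i,j})]\in M_n(\mathbb{C})$, $1_{n,\Omega}=\mathrm{diag}(\Omega,\dots,\Omega)$ and $tr$ is the normalized trace. Convergence in distribution means convergence of all joint moments (equivalently, of all bi-free cumulants). Bi-free cumulants. For $\chi:\{1,\dots,m\}\to\{l,r\}$ with $\chi^{-1}(\{l\})=\{i_1<\dots<i_q\}$ and $\chi^{-1}(\{r\})=\{i_{q+1}>\dots>i_m\}$, let $s_\chi(k)=i_k$ and $BNC(\chi)=\{s_\chi\cdot\pi:\pi\in NC(m)\}$, where $NC(m)$ is the set of non-crossing partitions of $\{1,\dots,m\}$ and $s_\chi\cdot\pi=\{s_\chi(V):V\in\pi\}$. The bi-free cumulants $\kappa_\chi:\mathcal{B}^m\to\mathbb{C}$ of a non-commutative probability space $(\mathcal{B},\psi)$ are the multilinear functionals determined recursively by $$\psi(b_1\cdots b_m)=\sum_{\pi\in BNC(\chi)}\ \prod_{V\in\pi}\kappa_{\chi|_V}\big((b_1,\dots,b_m)|_V\big),$$ where for $V=\{v_1<\dots<v_k\}$ one sets $(b_1,\dots,b_m)|_V=(b_{v_1},\dots,b_{v_k})$ and $\chi|_V$ is viewed as a map on $\{1,\dots,k\}$. A pair $(z_l,z_r)$ has the compound bi-free Poisson distribution determined by $\lambda>0$ and the distribution of $(a_l,a_r)$ if $\kappa_\chi(z_{\chi(1)},\dots,z_{\chi(m)})=\lambda\,\varphi(a_{\chi(1)}\cdots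 a_{\chi(m)})$ for all $m\ge1$ and $\chi:\{1,\dots,m\}\to\{l,r\}$. *)

(* Defs.v *)
From HB Require Import structures.
From mathcomp Require Import all_boot all_order all_algebra.
From mathcomp Require Import boolp.

Set Implicit Arguments.
Unset Strict Implicit.
Unset Printing Implicit Defensive.

Import Order.TTheory GRing.Theory Num.Theory.

Local Open Scope ring_scope.

Inductive side := lft | rgt.
Definition is_lft (s : side) : bool := if s is lft then true else false.

Section Cumulants.

Definition noncrossing m (P : {set {set 'I_m}}) : bool :=
  partition P [set: 'I_m] &&
  [forall V in P, forall W in P, [forall a in V, forall b in W, forall c in V,
     forall d in W, (a < b)%N && (b < c)%N && (c < d)%N ==> (V == W)]].

Definition s_seq m (chi : 'I_m -> side) : seq 'I_m :=
  [seq i <- enum 'I_m | is_lft (chi i)] ++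
  rev [seq i <- enum 'I_m | ~~ is_lft (chi i)].

(* [s_seq chi] has size [m], so the default value of [nth] is never used. *)
Definition s_chi m (chi : 'I_m -> side) (k : 'I_m) : 'I_m :=
  nth k (s_seq chi) k.

Definition bnc m (chi : 'I_m -> side) : {set {set {set 'I_m}}} :=
  [set [set s_chi chi @: (V : {set 'I_m}) | V in (P : {set {set 'I_m}})]
  | P : {set {set 'I_m}} & noncrossing P].

(* [enum_val] lists [V] in increasing order, so this is the word w|_V. *)
Definition subword T m (w : 'I_m -> T) (V : {set 'I_m}) : 'I_#|V| -> T :=
  fun k => w (enum_val k).
Arguments subword {T m} w V k.

Context {K : comPzRingType} {B : pzRingType} (psi : B -> K).

(* The moment-cumulant recursion solved for the term of the one-block
   partition; [fuel] only serves structural termination (the blocks of every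
   other partition have fewer than [m] elements). *)
Fixpoint cumulant_rec (fuel : nat) m (chi : 'I_m -> side) (b : 'I_m -> B) : K :=
  if fuel is f.+1 then
    psi (\prod_(i < m) b i) -
    \sum_(P in bnc chi | P != [set [set: 'I_m]])
       \prod_(V in P) cumulant_rec f (subword chi V) (subword b V)
  else 0.

Definition bifree_cumulant m (chi : 'I_m -> side) (b : 'I_m -> B) : K :=
  cumulant_rec m chi b.

Lemma s_seq_perm m (chi : 'I_m -> side) : perm_eq (s_seq chi) (enum 'I_m).
Proof.
rewrite /s_seq (perm_trans _ (permEl (perm_filterC (is_lft \o chi) _)))//.
by rewrite perm_cat2l perm_rev.
Qed.

Lemma s_chi_inj m (chi : 'I_m -> side) : injective (s_chi chi).
Proof.
move=> i j; rewrite /s_chi.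
have sz : size (s_seq chi) = m by rewrite (perm_size (s_seq_perm chi)) size_enum_ord.
rewrite (set_nth_default i j) ?sz// => /eqP.
by rewrite nth_uniq ?sz// ?(perm_uniq (s_seq_perm chi)) ?enum_uniq// => /eqP/val_inj.
Qed.

Lemma bnc_partition m (chi : 'I_m -> side) P :
  P \in bnc chi -> partition P [set: 'I_m].
Proof.
move=> /imsetP[Q]; rewrite inE => /andP[Qpart _] ->.
have inj := @s_chi_inj m chi.
suff -> : [set: 'I_m] = s_chi chi @: [set: 'I_m].
  by rewrite imset_partition// => x y _ _; apply: inj.
by apply/esym/eqP; rewrite eqEcard subsetT /= (card_imset _ inj).
Qed.

Lemma one_block_bnc m (chi : 'I_m -> side) :
  (0 < m)%N -> [set [set: 'I_m]] \in bnc chi.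
Proof.
move=> m0; apply/imsetP; exists [set [set: 'I_m]].
  rewrite inE; apply/andP; split.
    rewrite /partition finset.cover1 finset.trivIset1 eqxx /=.
    by rewrite in_set1 eq_sym; apply/set0Pn; exists (Ordinal m0); rewrite inE.
  apply/forall_inP => V /set1P ->; apply/forall_inP => W /set1P ->.
  do 4 (apply/forall_inP => ? _); exact/implyP.
rewrite imset_set1; congr [set _].
by apply/esym/eqP; rewrite eqEcard subsetT /= (card_imset _ (@s_chi_inj m chi)).
Qed.

Lemma bnc_block_card m (chi : 'I_m -> side) P (V : {set 'I_m}) :
  P \in bnc chi -> P != [set [set: 'I_m]] -> V \in P -> (0 < #|V| < m)%N.
Proof.
move=> /bnc_partition Ppart PN VP.
have V0 : V != set0 := partition_neq0 Ppart VP.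
rewrite card_gt0 V0/= ltn_neqAle -[leqRHS]card_ord max_card andbT.
apply: contra PN => /eqP cV; have VT : V = [set: 'I_m].
  by apply/eqP; rewrite eqEcard subsetT cardsT card_ord cV/=.
rewrite eqEsubset; apply/andP; split; apply/fintype.subsetP => W; last first.
  by move=> /set1P ->; rewrite -VT.
move=> WP; apply/set1P; have [//|WV] := eqVneq W [set: 'I_m].
have /eqP W0 := partition_neq0 Ppart WP; case: W0.
have := partition_trivIset Ppart => /trivIsetP/(_ W V WP VP).
by rewrite VT => /(_ WV); rewrite -setI_eq0 setIT => /eqP.
Qed.

Lemma cumulant_recE (f g m : nat) (chi : 'I_m -> side) (b : 'I_m -> B) :
  (0 < m)%N -> (m <= f)%N -> (m <= g)%N ->
  cumulant_rec f chi b = cumulant_rec g chi b.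
Proof.
elim: f g m chi b => [|f IH] [|g] m chi b m0 mf mg;
  rewrite ?(leqNgt m 0) ?m0// in mf mg *.
rewrite /=; congr (_ - _); apply: eq_bigr => P /andP[Pb PN].
apply: eq_bigr => V VP; have /andP[V0 Vm] := bnc_block_card Pb PN VP.
by apply: IH => //; rewrite -ltnS (leq_trans Vm).
Qed.

Lemma cumulant_subwordT m (chi : 'I_m -> side) (b : 'I_m -> B) :
  bifree_cumulant (subword chi [set: 'I_m]) (subword b [set: 'I_m]) =
  bifree_cumulant chi b.
Proof.
have cast p (e : p = m) (h : 'I_p -> 'I_m) : h =1 cast_ord e ->
    bifree_cumulant (chi \o h) (b \o h) = bifree_cumulant chi b.
  subst p => hE; suff -> : h = id by [].
  by apply/funext => i; rewrite hE; apply/val_inj.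
have e : #|[set: 'I_m]| = m by rewrite cardsT card_ord.
apply: (cast _ e) => i; apply/val_inj => /=.
rewrite /enum_val -[RHS](@nth_enum_ord m (enum_default i)); last first.
  by rewrite -[ltnRHS]e.
by congr (nat_of_ord (nth _ _ _)); apply: eq_enum => x; rewrite inE.
Qed.

Theorem moment_cumulant m (chi : 'I_m -> side) (b : 'I_m -> B) : (0 < m)%N ->
  psi (\prod_(i < m) b i) = \sum_(P in bnc chi)
    \prod_(V in P) bifree_cumulant (subword chi V) (subword b V).
Proof.
case: m chi b => // m chi b _; rewrite (bigD1 [set [set: 'I_m.+1]]) /=; last first.
  exact: one_block_bnc.
rewrite big_set1 cumulant_subwordT {1}/bifree_cumulant /=.
rewrite -addrA [X in _ = _ + X](_ : _ = 0) ?addr0//.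
apply/eqP; rewrite addrC subr_eq0; apply/eqP.
apply: eq_bigr => P /andP[Pb PN]; apply: eq_bigr => V VP.
have /andP[V0 Vm] := bnc_block_card Pb PN VP.
exact: cumulant_recE.
Qed.

End Cumulants.

From mathcomp Require Import all_classical all_reals all_analysis.
From mathcomp Require Import complex.

Import numFieldNormedType.Exports.

Local Open Scope classical_set_scope.
Local Open Scope complex_scope.

Definition endo (K : comPzRingType) (V : lmodType K) : Type := {linear V -> V}.
Identity Coercion endo_linear : endo >-> GRing.Linear.type.

Section Endo.
Context {K : comPzRingType} {V : lmodType K}.

HB.instance Definition _ := gen_eqMixin (endo V).
HB.instance Definition _ := gen_choiceMixin (endo V).

Lemma endoP (A B : endo V) : (A : V -> V) =1 B -> A = B.
Proof.
case: A => f [[f1] [f2]]; case: B => g [[g1] [g2]] /= /funext fg; subst g.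
by rewrite (Prop_irrelevance f1 g1) (Prop_irrelevance f2 g2).
Qed.

Definition endo_zero : endo V := (\0 : V -> V).
Definition endo_opp (A : endo V) : endo V := \- A.
Definition endo_add (A B : endo V) : endo V := A \+ B.
Definition endo_one : endo V := (idfun : V -> V).
Definition endo_comp (A B : endo V) : endo V := A \o B.
Definition endo_scale (c : K) (A : endo V) : endo V := c \*: A.

Fact endo_addA : associative endo_add.
Proof. by move=> A B C; apply/endoP => x /=; rewrite addrA. Qed.
Fact endo_addC : commutative endo_add.
Proof. by move=> A B; apply/endoP => x /=; rewrite addrC. Qed.
Fact endo_add0 : left_id endo_zero endo_add.
Proof. by move=> A; apply/endoP => x /=; rewrite add0r. Qed.
Fact endo_addN : left_inverse endo_zero endo_opp endo_add.
Proof. by move=> A; apply/endoP => x /=; rewrite addNr. Qed.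
HB.instance Definition _ :=
  GRing.isZmodule.Build (endo V) endo_addA endo_addC endo_add0 endo_addN.

Fact endo_compA : associative endo_comp.
Proof. by move=> A B C; apply/endoP. Qed.
Fact endo_comp1l : left_id endo_one endo_comp.
Proof. by move=> A; apply/endoP. Qed.
Fact endo_comp1r : right_id endo_one endo_comp.
Proof. by move=> A; apply/endoP. Qed.
Fact endo_compDl : left_distributive endo_comp +%R.
Proof. by move=> A B C; apply/endoP. Qed.
Fact endo_compDr : right_distributive endo_comp +%R.
Proof. by move=> A B C; apply/endoP => x /=; rewrite linearD. Qed.
HB.instance Definition _ := GRing.Zmodule_isPzRing.Build (endo V)
  endo_compA endo_comp1l endo_comp1r endo_compDl endo_compDr.

Fact endo_scaleA (a b : K) (A : endo V) :
  endo_scale a (endo_scale b A) = endo_scale (a * b) A.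
Proof. by apply/endoP => x /=; rewrite scalerA. Qed.
Fact endo_scale1 : left_id 1 endo_scale.
Proof. by move=> A; apply/endoP => x /=; rewrite scale1r. Qed.
Fact endo_scaleDr : right_distributive endo_scale +%R.
Proof. by move=> c A B; apply/endoP => x /=; rewrite scalerDr. Qed.
Fact endo_scaleDl (A : endo V) : {morph endo_scale^~ A : a b / a + b}.
Proof. by move=> a b; apply/endoP => x /=; rewrite scalerDl. Qed.
HB.instance Definition _ := GRing.Zmodule_isLmodule.Build K (endo V)
  endo_scaleA endo_scale1 endo_scaleDr endo_scaleDl.

End Endo.

(* M_n(V) as a module over the scalars of V; the library only provides the
   module structure of 'M[V]_n over V itself, when V is a ring. *)
Definition mxmod (K : pzRingType) (V : lmodType K) (n : nat) : Type := 'M[V]_n.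
Identity Coercion mxmod_matrix : mxmod >-> matrix.

Section MxMod.
Context {K : pzRingType} {V : lmodType K} {n : nat}.

HB.instance Definition _ := GRing.Zmodule.copy (mxmod V n) 'M[V]_n.

Definition mxmod_scale (c : K) (M : mxmod V n) : mxmod V n :=
  \matrix_(i, j) (c *: M i j).

Fact mxmod_scaleA (a b : K) (M : mxmod V n) :
  mxmod_scale a (mxmod_scale b M) = mxmod_scale (a * b) M.
Proof. by apply/matrixP => i j; rewrite !mxE scalerA. Qed.
Fact mxmod_scale1 : left_id 1 mxmod_scale.
Proof. by move=> M; apply/matrixP => i j; rewrite !mxE scale1r. Qed.
Fact mxmod_scaleDr : right_distributive mxmod_scale +%R.
Proof. by move=> c M N; apply/matrixP => i j; rewrite !mxE scalerDr. Qed.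
Fact mxmod_scaleDl (M : mxmod V n) : {morph mxmod_scale^~ M : a b / a + b}.
Proof. by move=> a b; apply/matrixP => i j; rewrite !mxE scalerDl. Qed.
HB.instance Definition _ := GRing.Zmodule_isLmodule.Build K (mxmod V n)
  mxmod_scaleA mxmod_scale1 mxmod_scaleDr mxmod_scaleDl.

End MxMod.

Section OperatorMatrices.
Context {K : comPzRingType} {V : lmodType K} {n : nat}.
Implicit Types (T : 'M[endo V]_n) (eta : mxmod V n).

Definition left_mx_fun T eta : mxmod V n :=
  \matrix_(i, j) \sum_(k < n) T i k (eta k j).

Definition right_mx_fun T eta : mxmod V n :=
  \matrix_(i, j) \sum_(k < n) T k j (eta i k).

Fact left_mx_fun_linear T : linear (left_mx_fun T).
Proof.
move=> c M N; apply/matrixP => i j; rewrite !mxE scaler_sumr -big_split/=.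
by apply: eq_bigr => k _; rewrite !mxE linearP.
Qed.

Fact right_mx_fun_linear T : linear (right_mx_fun T).
Proof.
move=> c M N; apply/matrixP => i j; rewrite !mxE scaler_sumr -big_split/=.
by apply: eq_bigr => k _; rewrite !mxE linearP.
Qed.

HB.instance Definition _ T := GRing.isLinear.Build K (mxmod V n) (mxmod V n) _
  (left_mx_fun T) (left_mx_fun_linear T).
HB.instance Definition _ T := GRing.isLinear.Build K (mxmod V n) (mxmod V n) _
  (right_mx_fun T) (right_mx_fun_linear T).

Definition left_matrix T : endo (mxmod V n) := left_mx_fun T.
Definition right_matrix T : endo (mxmod V n) := right_mx_fun T.

End OperatorMatrices.

(* The scalar product is linear in its first argument. *)
Record hilbertSpace (R : realType) := HilbertSpace {
  hilbert_car :> completeNormedModType R[i];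
  dotp : {dot hilbert_car for Num.conj};
  dotp_norm : forall x : hilbert_car, `|x| ^+ 2 = dotp x x }.
Arguments dotp {R} h.

Definition lin_span (K : pzRingType) (V : lmodType K) (S : set V) : set V :=
  [set x | exists k (c : 'I_k -> K) (v : 'I_k -> V),
     (forall i, S (v i)) /\ x = \sum_(i < k) c i *: v i].

(* The full Fock space of [H]: the completion of the tensor algebra of [H] for
   the scalar product that makes tensors of different lengths orthogonal and is
   the product of the scalar products of the factors on each tensor power. It
   is presented by its elementary tensors [tens [:: h_1; ...; h_k]], the empty
   tensor being the vacuum; their scalar products and the density of their span
   determine it up to a unique unitary. Multilinearity of [tens] follows, the
   scalar product being definite. *)
Record fockSpace (R : realType) (H : hilbertSpace R) := FockSpace {
  fock_car :> hilbertSpace R;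
  tens : seq H -> fock_car;
  dotp_tens : forall u v : seq H, dotp fock_car (tens u) (tens v) =
    if size u == size v then \prod_(xy <- zip u v) dotp H xy.1 xy.2 else 0;
  tens_dense : closure (lin_span (range tens)) = setT }.
Arguments tens {R H} f.

Section Fock.
Context {R : realType} {H : hilbertSpace R} (F : fockSpace H).

Definition vacuum : F := tens F [::].

Definition fock0 : set F :=
  closure (lin_span [set tens F u | u in [set u : seq H | u != [::]]]).

(* The coefficient c of x = c Omega + x0 with x0 in [fock0]: see
   [vacuum_decomposition] and [vacuum_coefE]. *)
Definition vacuum_coef (x : F) : R[i] := dotp F x vacuum.

(* A continuous operator is determined by its values on elementary tensors, so
   [left_creation h A] says that A is l(h), the tensoring by h on the left. *)
Definition left_creation (h : H) (A : endo F) : Prop :=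
  continuous (A : F -> F) /\ forall u, A (tens F u) = tens F (h :: u).

Definition right_creation (h : H) (A : endo F) : Prop :=
  continuous (A : F -> F) /\ forall u, A (tens F u) = tens F (rcons u h).

Definition adjoint (A B : endo F) : Prop :=
  forall x y, dotp F (A x) y = dotp F x (B y).

Inductive creation_annihilation_algebra : endo F -> Prop :=
| CALeftCreation h A :
    left_creation h A -> creation_annihilation_algebra A
| CALeftAnnihilation h A B :
    left_creation h A -> adjoint A B -> creation_annihilation_algebra B
| CARightCreation h A :
    right_creation h A -> creation_annihilation_algebra A
| CARightAnnihilation h A B :
    right_creation h A -> adjoint A B -> creation_annihilation_algebra B
| CAOne : creation_annihilation_algebra 1
| CAScale (c : R[i]) A :
    creation_annihilation_algebra A -> creation_annihilation_algebra (c *: A)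
| CAAdd A B : creation_annihilation_algebra A ->
    creation_annihilation_algebra B -> creation_annihilation_algebra (A + B)
| CAMul A B : creation_annihilation_algebra A ->
    creation_annihilation_algebra B -> creation_annihilation_algebra (A * B).

Section Expectation.
Context {n : nat}.

Definition vacuum_mx : mxmod F n := vacuum%:M.

Definition expectation_mx (A : endo (mxmod F n)) : 'M[R[i]]_n :=
  \matrix_(i, j) vacuum_coef ((A vacuum_mx : mxmod F n) i j).

Definition vacuum_trace (A : endo (mxmod F n)) : R[i] :=
  n%:R^-1 * \tr (expectation_mx A).

End Expectation.

Lemma dotp_vacuum : dotp F vacuum vacuum = 1.
Proof. by rewrite dotp_tens eqxx big_nil. Qed.

Lemma vacuum_proj_norm (x : F) : `|x - vacuum_coef x *: vacuum| <= `|x|.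
Proof.
rewrite -(@ler_pXn2r _ 2)// ?nnegrE// !dotp_norm dnormB dnormZ dotp_vacuum mulr1.
rewrite linearZr_LR/= -/(vacuum_coef x) -normCKC.
rewrite (conj_Creal (ger0_real (exprn_ge0 2 (normr_ge0 _)))).
by rewrite opprD addrA addrK lerBlDr lerDl exprn_ge0.
Qed.

Fact vacuum_coefB (x y : F) :
  vacuum_coef (x - y) = vacuum_coef x - vacuum_coef y.
Proof. by rewrite /vacuum_coef linearBl. Qed.

Fact vacuum_coefZ (c : R[i]) (x : F) : vacuum_coef (c *: x) = c * vacuum_coef x.
Proof. by rewrite /vacuum_coef linearZl_LR. Qed.

Fact vacuum_coef_norm (x : F) : `|vacuum_coef x| <= `|x|.
Proof.
rewrite -(@ler_pXn2r _ 2)// ?nnegrE// dotp_norm.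
have := dnorm_ge0 (dotp F) (x - vacuum_coef x *: vacuum).
rewrite dnormB dnormZ dotp_vacuum mulr1.
rewrite linearZr_LR/= -/(vacuum_coef x) -normCKC.
rewrite (conj_Creal (ger0_real (exprn_ge0 2 (normr_ge0 _)))).
by rewrite opprD addrA addrK subr_ge0.
Qed.

Fact closure_normP (S : set F) (x : F) :
  closure S x <-> forall e : R[i], 0 < e -> exists2 y, S y & `|x - y| < e.
Proof.
split=> [Sx e e0|Sx B /nbhs_normP[e /= e0 eB]].
  have [y [Sy xy]] := Sx _ (nbhsx_ballx x e e0).
  by exists y => //; move: xy; rewrite -ball_normE.
by have [y Sy xy] := Sx e e0; exists y; split => //; exact: eB.
Qed.

Lemma vacuum_decomposition (x : F) :
  exists2 x0, fock0 x0 & x = vacuum_coef x *: vacuum + x0.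
Proof.
exists (x - vacuum_coef x *: vacuum); last by rewrite addrC subrK.
apply/closure_normP => e e0.
have /closure_normP/(_ e e0)[_ [k [c [v [vS ->]]]] xy] :
  closure (lin_span (range (tens F))) x by rewrite tens_dense.
set y := \sum_(i < k) _ in xy *.
exists (y - vacuum_coef y *: vacuum); last first.
  apply: le_lt_trans xy; apply: le_trans (vacuum_proj_norm _).
  by rewrite vacuum_coefB scalerBl !opprD !opprK addrACA.
have /choice[u uE] : forall i, exists u, tens F u = v i.
  by move=> i; have [u _ uE] := vS i; exists u.
pose c' i := if u i == [::] then 0 else c i.
pose v' i := if u i == [::] then tens F [:: 0] else v i.
exists k, c', v'; split=> [i|].
  rewrite /v'; case: ifPn => [_|ui]; first by exists [:: 0].
  by exists (u i); [exact: ui|exact: uE].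
rewrite /y /vacuum_coef linear_sumlz scaler_suml -sumrB; apply: eq_bigr => i _.
rewrite linearZl_LR/= -scalerA -scalerBr /c' /v' -uE dotp_tens.
case: (u i) => [|h w] /=; last by rewrite scale0r subr0.
by rewrite big_nil scale1r subrr scaler0 scale0r.
Qed.

Lemma vacuum_coefE (c : R[i]) (x0 : F) :
  fock0 x0 -> vacuum_coef (c *: vacuum + x0) = c.
Proof.
move=> x0F; rewrite /vacuum_coef linearDl linearZl_LR/= dotp_vacuum mulr1.
rewrite -[RHS]addr0; congr (_ + _); apply/eqP; rewrite -normr_eq0.
rewrite eq_le normr_ge0 andbT; apply/ler_addgt0Pl => e e0; rewrite addr0.
move/closure_normP : x0F => /(_ e e0)[y [k [d [v [vS yE]]]] xy].
have y0 : vacuum_coef y = 0.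
  rewrite yE /vacuum_coef linear_sumlz big1// => i _.
  have [[//|h w] _ <-] := vS i.
  by rewrite linearZl_LR/= dotp_tens mulr0.
rewrite -/(vacuum_coef x0) -[vacuum_coef x0]subr0 -y0 -vacuum_coefB.
by rewrite (le_trans (vacuum_coef_norm _))// ltW.
Qed.

End Fock.

Arguments vacuum_trace {R H} F n A.
Record ncps (R : realType) := NCPS {
  ncps_alg :> algType R[i];
  state : {scalar ncps_alg};
  state1 : state 1 = 1 }.
Arguments state {R} n.

Definition side_pair (T : Type) (x y : T) (s : side) : T :=
  if s is lft then x else y.

Section Distributions.
Context {R : realType}.

Definition compound_bifree_poisson (lambda : R) (A : ncps R) (a : side -> A)
    (C : ncps R) (z : side -> C) : Prop :=
  forall m (chi : 'I_m -> side), (0 < m)%N ->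
    bifree_cumulant (state C) chi (fun i => z (chi i)) =
    lambda%:C * state A (\prod_(i < m) a (chi i)).

(* [psi] is not required to be part of an [ncps R] because the operators on a
   module form a ring that is trivial when the module is. *)
Definition cvg_in_distribution (B : pzRingType) (psi : B -> R[i])
    (Z : nat -> side -> B) (C : ncps R) (z : side -> C) : Prop :=
  forall m (chi : 'I_m -> side),
    (fun N => psi (\prod_(i < m) Z N (chi i)) : R[i]^o) @ \oo -->
    (state C (\prod_(i < m) z (chi i)) : R[i]^o).

End Distributions.

(* Main.v *)
Require Import Defs.
From HB Require Import structures.
From mathcomp Require Import all_boot all_order all_algebra.
From mathcomp Require Import all_classical all_reals all_analysis.
From mathcomp Require Import complex.
From mathcomp Require Import ring.

Set Implicit Arguments.
Unset Strict Implicit.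
Unset Printing Implicit Defensive.

Import Order.TTheory GRing.Theory Num.Theory.
Import numFieldNormedType.Exports.

Local Open Scope classical_set_scope.
Local Open Scope complex_scope.
Local Open Scope ring_scope.

(** Write phi for [state A]. The limit cumulants lambda phi(a1^p a2^q) depend on
a word in the letters l and r only through the numbers p of l's and q of r's,
because a1 and a2 commute. Once the order [s_chi] turns bi-non-crossing
partitions into non-crossing ones, the positions of the left letters become an
initial segment, so the limit moments, too, depend only on p and q: they form an
array M(p, q) with M(0, 0) = 1 (lemma [bnc_sum]). Moments of words of length at
most m determine the cumulants of words of length at most m
([cumulant_of_moments]); so it is enough to find, for every N, a pair whose
moments are exactly M(p, q) for the words of length at most N. Every sequence in
the statement is then eventually constant.

Such a pair exists already on the Fock space of a line, which is the space
l^2 with the vacuum e_0 as first basis vector. Let S be the creation operator of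
the unit vector, that is, the unilateral shift. The operators S and S^(N+1)
commute, and p factors S and q factors S^(N+1) send e_0 to e_d with
d = p + (N+1) q, from which p and q can be read off when p, q <= N. To make the
vacuum coefficient of the resulting vector equal to M(p, q), conjugate both
operators by 1 + K, where K x = (sum_k g_k x_k) e_0, the sum being over
0 < k < (N+1)^2 and g_d = M(p, q). As K kills e_0, it has square zero, 1 - K is
the inverse of 1 + K, and the word becomes (1 + K) S^d (1 - K), which maps e_0
to e_d + g_d e_0 ([conj_shift_vacuum]). If B is the adjoint of S, then 1 - S B
is the projection onto the vacuum and K is the finite sum of the
g_k (1 - S B) B^k, so K lies in the algebra generated by S and B. The operators
obtained are not self-adjoint, which leaves room for an arbitrary functional
phi.

For n x n matrices, put the left operator on the diagonal of a left matrix and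
the right operator on the diagonal of a right matrix. Both act entrywise, so the
trace of a word is its vacuum coefficient ([vacuum_trace_diagonal_word]).

Most of the work is the Hilbert space l^2 itself: its scalar product as a limit
of partial sums, its completeness ([ell2_complete]), and the density of the
finitely supported sequences ([ell2_truncation]), which makes it a full Fock
space ([line_fock]). *)

(** * Complex numbers and their completeness *)

Local Notation Re := (@complex.Re _).
Local Notation Im := (@complex.Im _).

Section ComplexNumbers.
Context {R : realType}.
Implicit Types (z w : R[i]).

(** The square of the modulus as a real number: convergence questions are
settled in [R], where completeness and monotone convergence are available. *)
Definition sqmod z : R := Re z ^+ 2 + Im z ^+ 2.

Lemma sqmod_norm z : (sqmod z)%:C = `|z| ^+ 2.
Proof. exact: add_Re2_Im2. Qed.

Lemma sqmod_ge0 z : 0 <= sqmod z.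
Proof. by rewrite addr_ge0 ?sqr_ge0. Qed.

Lemma sqmod_mulJ z : (sqmod z)%:C = z * Num.conj z.
Proof. by rewrite sqmod_norm normCK. Qed.

Lemma gt0_complex_Re (e : R[i]) : 0 < e -> e = (Re e)%:C /\ 0 < Re e.
Proof. by case: e => a b; rewrite ltcE /= => /andP[/eqP -> a0]. Qed.

Lemma norm_Re_le z : `|Re z|%:C <= `|z|.
Proof. exact: normc_ge_Re. Qed.

Lemma norm_Im_le z : `|Im z|%:C <= `|z|.
Proof.
have := norm_Re_le (z * 'i).
by rewrite ReiNIm normrN normrM (_ : `|'i%C : R[i]| = 1) ?mulr1// normc_def /=
  expr0n add0r expr1n sqrtr1.
Qed.

Lemma norm_le_ReIm z : `|z| <= (`|Re z| + `|Im z|)%:C.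
Proof.
rewrite [in `|z|](complexE z) (le_trans (ler_normD _ _))// rmorphD /=.
rewrite lerD// ?normrM !normc_def /= !expr0n /= ?addr0 ?add0r ?expr1n ?sqrtr1.
  by rewrite sqrtr_sqr.
by rewrite mul1r sqrtr_sqr.
Qed.

(** Real coordinates that are dominated by the norm have limits along Cauchy
filters. Both completeness proofs start by collecting such limits, for the real
and imaginary parts on the complex line and for those of each entry on l^2. *)
Lemma cauchy_contraction_cvg (V : normedModType R[i]) (F : set_system V)
    (p : V -> R) :
  ProperFilter F -> cauchy F -> {morph p : x y / x - y} ->
  (forall x, `|p x|%:C <= `|x|) -> cvg (p @ F).
Proof.
move=> FF /cauchyP Fc pB ple; apply: cauchy_cvg; apply: cauchy_exP => e e0.
have [|z Fz] := Fc e%:C; first by rewrite ltcR.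
exists (p z); change (F (p @^-1` ball (p z) e)).
apply: filterS Fz => w; rewrite /preimage /= -!ball_normE /= => zw.
by rewrite -ltcR -pB (le_lt_trans (ple _)).
Qed.

Lemma complex_cauchy_cvg (F : set_system R[i]^o) :
  ProperFilter F -> cauchy F -> cvg F.
Proof.
move=> FF Fc.
have /cvg_ex[/= a Fa] : cvg (Re @ F).
  apply: (cauchy_contraction_cvg FF Fc) => [[? ?] [? ?]//|]; exact: norm_Re_le.
have /cvg_ex[/= b Fb] : cvg (Im @ F).
  apply: (cauchy_contraction_cvg FF Fc) => [[? ?] [? ?]//|]; exact: norm_Im_le.
apply/cvg_ex; exists (a +i* b); apply/cvgrPdist_lt => e /gt0_complex_Re[eE e0].
have e2 : 0 < Re e / 2 by rewrite divr_gt0.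
move/cvgrPdist_lt/(_ _ e2): Fa => Fa; move/cvgrPdist_lt/(_ _ e2): Fb => Fb.
near=> z.
rewrite (le_lt_trans (norm_le_ReIm _))// eE ltcR.
have zE : (Re (a +i* b - z) = a - Re z) * (Im (a +i* b - z) = b - Im z).
  by case: (z).
rewrite !zE [ltRHS]splitr ltrD//; by near: z.
Unshelve. all: by end_near. Qed.

End ComplexNumbers.

(** A copy of the normed space [R[i]^o] on which completeness can be declared:
the structures of [R[i]^o] are those of an arbitrary ring of scalars. *)
Definition complex_line (R : realType) : Type := R[i]^o.
HB.instance Definition _ (R : realType) :=
  NormedModule.copy (complex_line R) R[i]^o.
HB.instance Definition _ (R : realType) :=
  Uniform_isComplete.Build (complex_line R) (@complex_cauchy_cvg R).

(** * The space of square-summable sequences *)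

Section SquareSummable.
Context {R : realType}.
Implicit Types (z w : R[i]) (f g h : nat -> R[i]) (u v : nat -> R[i]).

Lemma sqmodM z w : sqmod (z * w) = sqmod z * sqmod w.
Proof. by case: z w => [a b] [c d]; rewrite /sqmod /=; ring. Qed.

Lemma sqmodD_le z w : sqmod (z + w) <= 2 * (sqmod z + sqmod w).
Proof.
rewrite -subr_ge0 (_ : _ - _ = sqmod (z - w)) ?sqmod_ge0//.
by case: z w => [a b] [c d]; rewrite /sqmod /=; ring.
Qed.

(** Polarization. Together with [Im_mulJ] it reduces the convergence of the
scalar product of two sequences to the convergence of sums of squares. *)
Lemma Re_mulJ z w :
  Re (z * Num.conj w) = 2^-1 * (sqmod (z + w) - (sqmod z + sqmod w)).
Proof. by case: z w => [a b] [c d]; rewrite /sqmod /=; field. Qed.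

Lemma Im_mulJ z w : Im (z * Num.conj w) = Re (z * Num.conj ('i * w)).
Proof. by case: z w => [a b] [c d] /=; ring. Qed.

Definition square_summable : set (nat -> R[i]) :=
  [set f : nat -> R[i] | exists M, forall n, \sum_(k < n) sqmod (f k) <= M].

Definition square_summable_pred : {pred nat -> R[i]} := mem square_summable.

Fact square_summable_submod : submod_closed square_summable_pred.
Proof.
split; first by rewrite inE; exists 0 => n; rewrite big1// => k _;
  rewrite /sqmod /= expr0n addr0.
move=> a f g; rewrite !inE => -[M fM] [N gN].
exists (2 * (sqmod a * M + N)) => n.
have := lerD (ler_wpM2l (sqmod_ge0 a) (fM n)) (gN n).
rewrite -(ler_pM2l (ltr0Sn _ 1)); apply: le_trans.
rewrite mulr_sumr -big_split mulr_sumr/=; apply: ler_sum => k _.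
by rewrite (le_trans (sqmodD_le _ _))// sqmodM.
Qed.

HB.instance Definition _ := GRing.isSubmodClosed.Build R[i] (nat -> R[i])
  square_summable_pred square_summable_submod.

End SquareSummable.

Record ell2 (R : realType) := Ell2 {
  coord :> nat -> R[i];
  _ : coord \in square_summable_pred }.

HB.instance Definition _ (R : realType) := [isSub for @coord R].
HB.instance Definition _ (R : realType) := [Choice of ell2 R by <:].
HB.instance Definition _ (R : realType) :=
  [SubChoice_isSubLmodule of ell2 R by <:].

Section Ell2DotProduct.
Context {R : realType}.
Implicit Types (z w : R[i]) (x y t : ell2 R) (u v : nat -> R[i]).

Lemma coordD x y k : (x + y) k = x k + y k. Proof. by []. Qed.
Lemma coordB x y k : (x - y) k = x k - y k. Proof. by []. Qed.
Lemma coordZ z x k : (z *: x) k = z * x k. Proof. by []. Qed.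
Lemma coord0 k : (0 : ell2 R) k = 0. Proof. by []. Qed.

Lemma ell2P x y : (forall k, x k = y k) -> x = y.
Proof. by move=> /funext xy; apply/val_inj. Qed.

Lemma sqsum_cvg x : cvgn (fun n => \sum_(k < n) sqmod (x k)).
Proof.
apply: nondecreasing_is_cvgn.
  apply/nondecreasing_seqP => n.
  by rewrite big_ord_recr /= lerDl sqmod_ge0.
have /set_mem[M xM] := valP x.
by exists M => _ [n _ <-].
Qed.

Definition dot_partial x y n : R[i] := \sum_(k < n) x k * Num.conj (y k).

Lemma Re_sum n (u : 'I_n -> R[i]) : Re (\sum_k u k) = \sum_k Re (u k).
Proof. by apply: (big_morph (@complex.Re R)) => // -[? ?] [? ?]. Qed.

Lemma Im_sum n (u : 'I_n -> R[i]) : Im (\sum_k u k) = \sum_k Im (u k).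
Proof. by apply: (big_morph (@complex.Im R)) => // -[? ?] [? ?]. Qed.

Lemma Re_dot_cvg x y : cvgn (fun n => Re (dot_partial x y n)).
Proof.
rewrite (_ : (fun _ => _) = fun n => 2^-1 * (\sum_(k < n) sqmod ((x + y) k) -
  (\sum_(k < n) sqmod (x k) + \sum_(k < n) sqmod (y k)))); last first.
  apply/funext => n; rewrite Re_sum -big_split -sumrB mulr_sumr /=.
  by apply: eq_bigr => k _; rewrite Re_mulJ.
by apply: is_cvgM; [exact: is_cvg_cst|apply: is_cvgB;
  [|apply: is_cvgD]; exact: sqsum_cvg].
Qed.

Lemma Im_dot_cvg x y : cvgn (fun n => Im (dot_partial x y n)).
Proof.
rewrite (_ : (fun _ => _) = fun n => Re (dot_partial x ('i *: y) n)).
  exact: Re_dot_cvg.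
apply/funext => n; rewrite Re_sum Im_sum.
by apply: eq_bigr => k _; rewrite Im_mulJ.
Qed.

Definition ell2_dot x y : R[i] :=
  limn (fun n => Re (dot_partial x y n)) +i*
  limn (fun n => Im (dot_partial x y n)).

(** Identities for the scalar product hold for the partial sums and pass to the
limit; this lemma closes such arguments. *)
Lemma ell2_dotE x y z :
  (fun n => Re (dot_partial x y n)) @ \oo --> Re z ->
  (fun n => Im (dot_partial x y n)) @ \oo --> Im z -> ell2_dot x y = z.
Proof.
by move=> xa xb; rewrite /ell2_dot !(cvg_lim _ xa, cvg_lim _ xb)//; case: (z).
Qed.

Lemma Re_dotP x y :
  (fun n => Re (dot_partial x y n)) @ \oo --> Re (ell2_dot x y).
Proof. exact: Re_dot_cvg. Qed.

Lemma Im_dotP x y :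
  (fun n => Im (dot_partial x y n)) @ \oo --> Im (ell2_dot x y).
Proof. exact: Im_dot_cvg. Qed.

Fact ell2_dotPl t a x y :
  ell2_dot (a *: x + y) t = a * ell2_dot x t + ell2_dot y t.
Proof.
have E n : dot_partial (a *: x + y) t n =
    a * dot_partial x t n + dot_partial y t n.
  rewrite mulr_sumr -big_split /=; apply: eq_bigr => k _.
  by rewrite mulrA -mulrDl.
have RE z w : Re (a * z + w) = Re a * Re z - Im a * Im z + Re w.
  by case: a z w {E} => [? ?] [? ?] [? ?].
have IE z w : Im (a * z + w) = Re a * Im z + Im a * Re z + Im w.
  by case: a z w {E RE} => [? ?] [? ?] [? ?].
apply: ell2_dotE; under eq_fun do rewrite E ?RE ?IE.
  rewrite RE; apply: cvgD; last exact: Re_dotP.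
  by apply: cvgB; apply: cvgMr; [exact: Re_dotP|exact: Im_dotP].
rewrite IE; apply: cvgD; last exact: Im_dotP.
by apply: cvgD; apply: cvgMr; [exact: Im_dotP|exact: Re_dotP].
Qed.

Fact ell2_dotC x y : ell2_dot x y = Num.conj (ell2_dot y x).
Proof.
have E n : dot_partial x y n = Num.conj (dot_partial y x n).
  rewrite rmorph_sum; apply: eq_bigr => k _.
  by rewrite rmorphM/= conjCK mulrC.
have RE z : Re (Num.conj z) = Re z by case: z.
have IE z : Im (Num.conj z) = - Im z by case: z.
apply: ell2_dotE; under eq_fun do rewrite E ?RE ?IE; rewrite ?RE ?IE.
  exact: Re_dotP.
apply: cvgN; exact: Im_dotP.
Qed.

Lemma ell2_dot_sqmod x :
  ell2_dot x x = (limn (fun n => \sum_(k < n) sqmod (x k)))%:C.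
Proof.
have E n : dot_partial x x n = (\sum_(k < n) sqmod (x k))%:C.
  by rewrite rmorph_sum /=; apply: eq_bigr => k _; rewrite sqmod_mulJ.
apply: ell2_dotE; under eq_fun do rewrite E; first exact: sqsum_cvg.
exact: cvg_cst.
Qed.

Lemma sqsum_le_lim x n :
  \sum_(k < n) sqmod (x k) <= limn (fun n => \sum_(k < n) sqmod (x k)).
Proof.
apply: (@nondecreasing_cvgn_le _ (fun n => \sum_(k < n) sqmod (x k))).
  by apply/nondecreasing_seqP => p; rewrite big_ord_recr /= lerDl sqmod_ge0.
exact: sqsum_cvg.
Qed.

Lemma sqmod_coord_le x k :
  sqmod (x k) <= limn (fun n => \sum_(k < n) sqmod (x k)).
Proof.
apply: le_trans (sqsum_le_lim x k.+1).
by rewrite big_ord_recr /= lerDr sumr_ge0// => j _; exact: sqmod_ge0.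
Qed.

Fact ell2_dot_gt0 x : x != 0 -> 0 < ell2_dot x x.
Proof.
rewrite ell2_dot_sqmod ltcR; apply: contraNT; rewrite -leNgt => x0.
apply/eqP/ell2P => k; apply/eqP; rewrite coord0 -normr_eq0 -sqrf_eq0.
rewrite -sqmod_norm eq_le !lecR sqmod_ge0 andbT.
exact: le_trans (sqmod_coord_le x k) x0.
Qed.

Fact ell2_dot_bilinear : bilinear_for
  (GRing.Scale.Law.clone _ _ *%R _)
  (GRing.Scale.Law.clone _ _ (Num.conj \; *%R) _) ell2_dot.
Proof.
split=> [t a x y|t a x y]; first exact: ell2_dotPl.
by rewrite (ell2_dotC t x) (ell2_dotC t y) ell2_dotC ell2_dotPl rmorphD rmorphM.
Qed.

HB.instance Definition _ := bilinear_isBilinear.Build R[i] (ell2 R) (ell2 R)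
  R[i] _ _ ell2_dot ell2_dot_bilinear.
HB.instance Definition _ := isHermitianSesquilinear.Build R[i] (ell2 R) false
  Num.conj ell2_dot (fun x y => etrans (ell2_dotC x y) (esym (mul1r _))).
HB.instance Definition _ := isDotProduct.Build R[i] (ell2 R) ell2_dot
  ell2_dot_gt0.

End Ell2DotProduct.

(** * Norm and completeness of l^2 *)

Section NormFromDotProduct.
Context {C : numClosedFieldType} {V : lmodType C} (form : {dot V for Num.conj}).

(** The inequality reduces to that of Cauchy and Schwarz, which holds in a
module of any dimension. *)
Lemma dot_triangle (x y : V) :
  sqrtC (form (x + y) (x + y)) <= sqrtC (form x x) + sqrtC (form y y).
Proof.
have sqrt_ge0 u := sqrt_dnorm_ge0 form u.
rewrite -(@ler_pXn2r _ 2)// ?nnegrE ?addr_ge0// sqrrD !sqrtCK dnormD.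
rewrite [leRHS]addrAC lerD2l -mulr_natr.
have [->|y0] := eqVneq y 0.
  by rewrite !linear0r sqrtC0 conjC0 addr0 mulr0 mul0r.
set d := form x y; set a := form x x; set b := form y y.
have b0 : 0 < b by rewrite dnorm_gt0.
(* Cauchy-Schwarz: the component of [x] orthogonal to [y] has a nonnegative
   square. *)
have := dnorm_ge0 form (x - (d / b) *: y).
rewrite dnormB dnormZ linearZr_LR /= -/a -/b -/d.
rewrite normrM normfV (ger0_norm (ltW b0)) fmorph_div /= (geC0_conj (ltW b0)).
have -> : a + (`|d| / b) ^+ 2 * b -
    (d^* / b * d + (d^* / b * d)^* ) = a - `|d| ^+ 2 / b.
  rewrite !rmorphM /= fmorphV /= conjCK (geC0_conj (ltW b0)) expr_div_n normCK.
  by field; rewrite gt_eqF.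
rewrite subr_ge0 ler_pdivrMr// => dab.
have abCS : `|d| <= sqrtC a * sqrtC b.
  rewrite -(@ler_pXn2r _ 2)// ?nnegrE ?mulr_ge0 ?sqrt_ge0//.
  by rewrite exprMn !sqrtCK.
rewrite (le_trans _ (ler_wpM2r _ abCS))// ?ler0n//.
rewrite -[leLHS](divfK (negbT (pnatr_eq0 C 2))) -ReE ler_pM2r//.
exact: (leif_Re_Creal d).1.
Qed.

End NormFromDotProduct.

Section Ell2Normed.
Context {R : realType}.
Implicit Types (x y : ell2 R).

Definition ell2_norm x : R[i] := sqrtC (ell2_dot x x).

Fact ell2_normZ (a : R[i]) x : ell2_norm (a *: x) = `|a| * ell2_norm x.
Proof.
rewrite /ell2_norm dnormZ rootCMl ?exprn_ge0//; congr (_ * _).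
by rewrite sqrCK.
Qed.

Fact ell2_norm_eq0 x : ell2_norm x = 0 -> x = 0.
Proof. by move=> /eqP; rewrite sqrtC_eq0 dnorm_eq0 => /eqP. Qed.

HB.instance Definition _ := Lmodule_isNormed.Build R[i] (ell2 R)
  (dot_triangle (@ell2_dot R)) ell2_normZ ell2_norm_eq0.

Lemma ell2_dot_norm x : `|x| ^+ 2 = ell2_dot x x.
Proof. by rewrite sqrtCK. Qed.

Lemma norm_coord_le x k : `|x k| <= `|x|.
Proof.
rewrite -(@ler_pXn2r _ 2)// ?nnegrE// ell2_dot_norm ell2_dot_sqmod -sqmod_norm.
by rewrite lecR sqmod_coord_le.
Qed.

Lemma sqsum_le_norm x n (e : R) :
  `|x| <= e%:C -> \sum_(k < n) sqmod (x k) <= e ^+ 2.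
Proof.
move=> xe; have e0 : 0 <= e by rewrite -ler0c (le_trans _ xe).
apply: (le_trans (sqsum_le_lim x n)).
rewrite -lecR -ell2_dot_sqmod -ell2_dot_norm rmorphXn /=.
by rewrite ler_pXn2r// nnegrE ?ler0c.
Qed.

Lemma norm_le_sqsum x (e : R) : 0 <= e ->
  (forall n, \sum_(k < n) sqmod (x k) <= e ^+ 2) -> `|x| <= e%:C.
Proof.
move=> e0 xe; rewrite -(@ler_pXn2r _ 2)// ?nnegrE ?ler0c//.
rewrite ell2_dot_norm ell2_dot_sqmod -rmorphXn lecR /=.
by apply: limr_le; [exact: sqsum_cvg|exact: nearW].
Qed.

(** The coordinatewise limit [y] of a Cauchy filter is its limit in norm: if
the filter concentrates on the ball of radius [e] around [z], then the partial
sums of [z - y], as limits of those of [z - w] for [w] in that ball, are at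
most [e ^+ 2]. *)
Lemma ell2_complete (F : set_system (ell2 R)) :
  ProperFilter F -> cauchy F -> cvg F.
Proof.
move=> FF Fc.
have cvgRe k : cvg ((fun w : ell2 R => Re (w k)) @ F).
  apply: (cauchy_contraction_cvg FF Fc) => [x y|x].
    by rewrite coordB; case: (x k) (y k) => [? ?] [? ?].
  exact: le_trans (norm_Re_le _) (norm_coord_le _ _).
have cvgIm k : cvg ((fun w : ell2 R => Im (w k)) @ F).
  apply: (cauchy_contraction_cvg FF Fc) => [x y|x].
    by rewrite coordB; case: (x k) (y k) => [? ?] [? ?].
  exact: le_trans (norm_Im_le _) (norm_coord_le _ _).
pose y k : R[i] := lim ((fun w : ell2 R => Re (w k)) @ F) +i*
                   lim ((fun w : ell2 R => Im (w k)) @ F).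
have near_y (z : ell2 R) e : F (ball z e%:C) ->
    forall n, \sum_(k < n) sqmod (z k - y k) <= e ^+ 2.
  move=> Fz n.
  pose S (w : ell2 R) := \sum_(k < n) sqmod (z k - w k).
  have SF : S @ F --> \sum_(k < n) sqmod (z k - y k).
    apply: cvg_big => [|k _]; first exact: add_continuous.
    have E (a b : R[i]) : sqmod (a - b) =
        (Re a - Re b) * (Re a - Re b) + (Im a - Im b) * (Im a - Im b).
      by case: a b => [? ?] [? ?]; rewrite /sqmod /= !expr2.
    under eq_fun do rewrite E.
    have zRe : (fun w : ell2 R => Re (z k) - Re (w k)) @ F -->
        Re (z k) - Re (y k) by apply: cvgB; [exact: cvg_cst|exact: cvgRe].
    have zIm : (fun w : ell2 R => Im (z k) - Im (w k)) @ F -->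
        Im (z k) - Im (y k) by apply: cvgB; [exact: cvg_cst|exact: cvgIm].
    rewrite E; apply: cvgD; [apply: cvgM; exact: zRe|apply: cvgM; exact: zIm].
  rewrite -(cvg_lim _ SF)//; apply: limr_le.
    by apply/cvg_ex; eexists; exact: SF.
  apply: filterS Fz => w; rewrite -ball_normE /= => zw.
  exact: (@sqsum_le_norm (z - w)) (ltW zw).
move: (Fc) => /cauchyP Fx.
(* [y] is square summable because [z - y] is, for some [z] in the space. *)
have y2 : y \in square_summable_pred.
  have [z Fz] := Fx 1 ltr01.
  have zy : (z : nat -> R[i]) - y \in square_summable_pred.
    by rewrite inE; exists (1 ^+ 2) => n; exact: near_y Fz n.
  by rewrite -[y](subKr (z : nat -> R[i])) rpredB//; exact: valP z.
apply/cvg_ex; exists (Ell2 y2); apply/cvgrPdist_le => e /gt0_complex_Re[-> e0].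
have [|z Fz] := Fx (Re e / 2)%:C; first by rewrite ltcR divr_gt0.
apply: filterS (Fz) => w; rewrite -ball_normE /= => zw.
rewrite (le_trans (ler_distD z _ _))// [X in X%:C]splitr rmorphD /=.
apply: lerD (ltW zw); rewrite distrC; apply: norm_le_sqsum => [|n].
  by rewrite divr_ge0// ltW.
exact: near_y Fz n.
Qed.

HB.instance Definition _ := Uniform_isComplete.Build (ell2 R) ell2_complete.

End Ell2Normed.

(** * The full Fock space of a line *)

Section ComplexLine.
Context {R : realType}.

Definition line_dot (x y : complex_line R) : R[i] := x * Num.conj y.

Fact line_dot_bilinear : bilinear_for
  (GRing.Scale.Law.clone _ _ *%R _)
  (GRing.Scale.Law.clone _ _ (Num.conj \; *%R) _) line_dot.
Proof.
split=> [t a x y|t a x y]; rewrite /line_dot.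
  by rewrite mulrDl; congr (_ + _); exact: (esym (mulrA a x _)).
by rewrite rmorphD rmorphM mulrDr mulrCA.
Qed.

Fact line_dotC x y : line_dot x y = (-1) ^+ false * Num.conj (line_dot y x).
Proof. by rewrite mul1r /line_dot rmorphM /= conjCK mulrC. Qed.

Fact line_dot_gt0 x : x != 0 -> 0 < line_dot x x.
Proof. by rewrite /line_dot mul_conjC_gt0. Qed.

HB.instance Definition _ := bilinear_isBilinear.Build R[i] (complex_line R)
  (complex_line R) R[i] _ _ line_dot line_dot_bilinear.
HB.instance Definition _ := isHermitianSesquilinear.Build R[i] (complex_line R)
  false Num.conj line_dot line_dotC.
HB.instance Definition _ := isDotProduct.Build R[i] (complex_line R) line_dot
  line_dot_gt0.

Fact line_dot_norm (x : complex_line R) : `|x| ^+ 2 = line_dot x x.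
Proof. exact: normCK. Qed.

Definition line_hilbert : hilbertSpace R :=
  @HilbertSpace R (complex_line R) line_dot line_dot_norm.

Definition ell2_hilbert : hilbertSpace R :=
  @HilbertSpace R (ell2 R) (@ell2_dot R) (@ell2_dot_norm R).

End ComplexLine.

Section FockOfLine.
Context {R : realType}.
Implicit Types (x y : ell2 R) (j k n : nat).

Fact basis_square_summable k :
  (fun j => (j == k)%:R : R[i]) \in square_summable_pred.
Proof.
rewrite inE; exists 1 => n.
rewrite (le_trans (y := \sum_(j < n) (j == k :> nat)%:R))//.
  apply: ler_sum => j _; rewrite /sqmod.
  by case: eqP => _ /=; rewrite expr0n ?expr1n addr0.
rewrite -natr_sum -[leRHS]/(1%:R) ler_nat.
have [kn|nk] := ltnP k n.
  rewrite (bigD1 (Ordinal kn))//= eqxx big1// => j.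
  by rewrite -val_eqE /= => /negPf ->.
rewrite big1// => j _; rewrite ltn_eqF//.
exact: leq_trans (ltn_ord j) nk.
Qed.

(** The unit vectors [basis k] will be the [k]-fold tensor powers of the unit
vector of the line, the first one being the vacuum. *)
Definition basis k : ell2 R := Ell2 (basis_square_summable k).

Lemma basisE k j : basis k j = (j == k)%:R. Proof. by []. Qed.

Lemma dot_basis x k : ell2_dot x (basis k) = x k.
Proof.
have E n : (k < n)%N -> dot_partial x (basis k) n = x k.
  move=> kn; rewrite /dot_partial (bigD1 (Ordinal kn))//= eqxx conjC1 mulr1.
  rewrite big1 ?addr0// => j.
  by rewrite -val_eqE /= => /negPf ->; rewrite conjC0 mulr0.
by apply: ell2_dotE; apply: cvg_near_cst; exists k.+1 => // n /= kn; rewrite E.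
Qed.

Lemma ell2_truncation x (e : R[i]) : 0 < e ->
  exists n, `|x - \sum_(k < n) x k *: basis k| < e.
Proof.
move=> /gt0_complex_Re[eE e0]; rewrite eE.
have e2 : 0 < (Re e / 2) ^+ 2 by rewrite exprn_gt0// divr_gt0.
have /cvgrPdist_le/(_ _ e2)[n _ /(_ n (leqnn n))] := @sqsum_cvg _ x.
move=> /= xn; exists n; set y := _ - _.
have yE k : y k = if (k < n)%N then 0 else x k.
  rewrite coordB (big_morph (fun z : ell2 R => z k)
    (fun _ _ => erefl) (erefl : (0 : ell2 R) k = 0)).
  under eq_bigr do rewrite coordZ basisE eq_sym.
  have [kn|nk] := ltnP k n.
    rewrite (bigD1 (Ordinal kn))//= eqxx mulr1 big1 ?addr0 ?subrr// => j.
    by rewrite -val_eqE /= => /negPf ->; rewrite mulr0.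
  rewrite big1 ?subr0// => j _.
  by rewrite ltn_eqF ?mulr0// (leq_trans (ltn_ord j) nk).
clearbody y; apply: (@le_lt_trans _ _ (Re e / 2)%:C).
  apply: norm_le_sqsum => [|m]; first by rewrite divr_ge0// ltW.
  apply: le_trans (le_trans (ler_norm _) xn).
  rewrite lerBrDr; apply: le_trans (sqsum_le_lim x (n + m)).
  rewrite addrC big_split_ord lerD2l /=.
  have mono : {homo (fun p => \sum_(k < p) sqmod (y k)) :
      p q / (p <= q)%N >-> p <= q}.
    by apply/nondecreasing_seqP => p; rewrite big_ord_recr /= lerDl sqmod_ge0.
  apply: le_trans (mono _ _ (leq_addl n m)) _.
  rewrite big_split_ord /= big1 ?add0r => [|k _].
    by apply: ler_sum => k _; rewrite yE ltnNge leq_addr.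
  by rewrite yE ltn_ord /sqmod /= expr0n addr0.
by rewrite ltcR ltr_pdivrMr// ltr_pMr// ltr1n.
Qed.

(** All tensor powers of a line are lines: [h_1, ..., h_k] has the elementary
tensor h_1 ... h_k times the [k]-th unit vector. *)
Definition line_tens (u : seq (complex_line R)) : ell2 R :=
  (\prod_(c <- u) (c : R[i])) *: basis (size u).

Fact line_dotp_tens (u v : seq (@line_hilbert R)) :
  dotp (@ell2_hilbert R) (line_tens u) (line_tens v) =
  if size u == size v then
    \prod_(xy <- zip u v) dotp (@line_hilbert R) xy.1 xy.2 else 0.
Proof.
rewrite /= /line_tens linearZl_LR linearZr_LR /= dot_basis basisE eq_sym.
case: eqP => [|_]; last by rewrite !mulr0.
rewrite mulr1; elim: u v => [|a u IH] [|b v] //= => [_|[uv]].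
  by rewrite !big_nil conjC1 mulr1.
by rewrite !big_cons rmorphM mulrACA IH.
Qed.

Lemma line_tens_basis k : line_tens (nseq k 1) = basis k.
Proof.
rewrite /line_tens size_nseq big1_seq ?scale1r// => c /andP[_].
by rewrite mem_nseq => /andP[_ /eqP].
Qed.

Fact line_tens_dense :
  closure (lin_span (range line_tens)) = [set: ell2 R].
Proof.
apply/seteqP; split => // x _ B /nbhs_normP[e /= e0 eB].
have [n xn] := ell2_truncation x e0.
exists (\sum_(k < n) x k *: basis k); split; last exact: eB.
exists n, (fun k : 'I_n => x k), (fun k : 'I_n => basis k); split => // k.
by exists (nseq k 1) => //; exact: line_tens_basis.
Qed.

Definition line_fock : fockSpace (@line_hilbert R) :=
  @FockSpace R line_hilbert ell2_hilbert line_tens line_dotp_tens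
    line_tens_dense.

End FockOfLine.

Arguments line_hilbert R : clear implicits.
Arguments line_fock R : clear implicits.

(** * Creation and annihilation as shifts *)

Lemma linear_isometry_continuous (K : numFieldType) (V : normedModType K)
    (f : {linear V -> V}) :
  (forall x, `|f x| = `|x|) -> continuous f.
Proof.
move=> fn x; apply/cvgrPdist_lt => e e0; apply/nbhs_normP; exists e => // y.
by rewrite /= -linearB fn.
Qed.

Section Shifts.
Context {R : realType}.
Implicit Types (x y : ell2 R) (j k n : nat).
Local Notation F := (line_fock R).

Fact shift_square_summable x :
  (fun k => if k is j.+1 then x j else 0) \in square_summable_pred.
Proof.
have /set_mem[M xM] := valP x; rewrite inE; exists M => -[|n].
  by have := xM 0; rewrite !big_ord0.
by rewrite big_ord_recl /= /sqmod /= expr0n addr0 add0r xM.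
Qed.

Fact backshift_square_summable x : (fun k => x k.+1) \in square_summable_pred.
Proof.
have /set_mem[M xM] := valP x; rewrite inE; exists M => n.
by apply: le_trans (xM n.+1); rewrite big_ord_recl lerDr sqmod_ge0.
Qed.

Definition shift_fun x : ell2 R := Ell2 (shift_square_summable x).
Definition backshift_fun x : ell2 R := Ell2 (backshift_square_summable x).

Fact shift_linear : linear shift_fun.
Proof.
move=> a x y; apply/ell2P => -[|k]; last by [].
by rewrite coordD coordZ /= mulr0 addr0.
Qed.

Fact backshift_linear : linear backshift_fun.
Proof. by move=> a x y; apply/ell2P. Qed.

HB.instance Definition _ :=
  GRing.isLinear.Build R[i] (ell2 R) (ell2 R) _ shift_fun shift_linear.
HB.instance Definition _ :=
  GRing.isLinear.Build R[i] (ell2 R) (ell2 R) _ backshift_fun backshift_linear.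

Definition shift : endo F := (shift_fun : {linear ell2 R -> ell2 R}).
Definition backshift : endo F := (backshift_fun : {linear ell2 R -> ell2 R}).

Lemma shift_basis k : shift (basis k) = basis k.+1.
Proof. by apply/ell2P => -[|j]. Qed.

Lemma shift_adjoint x y : ell2_dot (shift x) y = ell2_dot x (backshift y).
Proof.
have E n : dot_partial (shift x) y n.+1 = dot_partial x (backshift y) n.
  by rewrite /dot_partial big_ord_recl /= mul0r add0r.
apply: ell2_dotE; rewrite -(cvg_shiftS _); under eq_fun do rewrite E.
  exact: Re_dotP.
exact: Im_dotP.
Qed.

Lemma shiftK x : backshift (shift x) = x.
Proof. exact/ell2P. Qed.

Lemma shift_norm x : `|shift x : ell2 R| = `|x|.
Proof.
apply/eqP; rewrite -(@eqrXn2 _ 2)// !ell2_dot_norm.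
by rewrite shift_adjoint shiftK.
Qed.

(** Creating the unit vector on the left multiplies by 1 and raises the degree
by one. *)
Lemma left_creation_shift : left_creation (F := F) 1 shift.
Proof.
split=> [|u].
  exact: (@linear_isometry_continuous _ _ (shift : {linear ell2 R -> ell2 R})
    shift_norm).
by rewrite /= /line_tens linearZ /= shift_basis big_cons mul1r.
Qed.

Lemma adjoint_shift : adjoint (F := F) shift backshift.
Proof. exact: shift_adjoint. Qed.

End Shifts.

(** * Operators with prescribed vacuum moments *)

Section ConjugatedShifts.
Context {R : realType}.
Implicit Types (x y : ell2 R) (d j k n : nat) (g : nat -> R[i]).
Local Notation F := (line_fock R).
Local Notation shift := (@shift R).
Local Notation backshift := (@backshift R).

(** The operator with [g 0, ..., g (D - 1)] as row 0 and zeros elsewhere (see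
[row_operatorE]), written inside the algebra of the shifts: the factor
[1 - shift * backshift] is the projection onto the vacuum. *)
Definition row_operator g D : endo F :=
  \sum_(k < D) g k *: ((1 - shift * backshift) * backshift ^+ k).

Lemma backshiftXE k x j : (backshift ^+ k) x j = x (k + j)%N.
Proof. by elim: k j => [//|k IH] j; rewrite exprS /= IH addnS. Qed.

Lemma shiftX_basis d k : (shift ^+ d) (basis k) = basis (d + k).
Proof. by elim: d => [//|d IH]; rewrite exprS /= IH shift_basis. Qed.

Lemma row_operatorE g D x :
  row_operator g D x = (\sum_(k < D) g k * x k) *: basis 0.
Proof.
rewrite /row_operator (big_morph (fun T : endo F => (T : _ -> _) x)
  (fun _ _ => erefl) (erefl : (0 : endo F) x = 0)).
rewrite scaler_suml; apply: eq_bigr => k _; rewrite -scalerA.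
congr (_ *: _); apply/ell2P => -[|j]; rewrite coordZ.
  rewrite mulr1.
  change ((backshift ^+ k) x 0%N - 0 = x k).
  by rewrite subr0 backshiftXE addn0.
rewrite mulr0.
change ((backshift ^+ k) x j.+1 - (backshift ^+ k) x j.+1 = 0).
by rewrite subrr.
Qed.

Lemma row_operator_basis g D d :
  row_operator g D (basis d) = (if (d < D)%N then g d else 0) *: basis 0.
Proof.
rewrite row_operatorE; congr (_ *: _).
have [dD|Dd] := ltnP d D.
  rewrite (bigD1 (Ordinal dD))//= eqxx mulr1 big1 ?addr0// => k.
  by rewrite -val_eqE /= => /negPf ->; rewrite mulr0.
rewrite big1// => k _; rewrite basisE ltn_eqF ?mulr0//.
exact: leq_trans (ltn_ord k) Dd.
Qed.

(** The values of the operator are multiples of [basis 0], which it kills when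
[g 0] vanishes. *)
Lemma row_operator_sqr0 g D :
  g 0%N = 0 -> row_operator g D * row_operator g D = 0.
Proof.
move=> g0; apply/endoP => x /=.
rewrite (row_operatorE _ _ x) linearZ /= row_operator_basis g0.
by rewrite if_same scale0r scaler0.
Qed.

(** When [g 0 = 0] the outer factors are inverse to each other, by
[row_operator_sqr0]. *)
Definition conj_shift g D d : endo F :=
  (1 + row_operator g D) * shift ^+ d * (1 - row_operator g D).

Lemma vacuumE : vacuum F = basis 0.
Proof. exact: (line_tens_basis 0%N). Qed.

Lemma conj_shift_prod g D I (r : seq I) (d : I -> nat) : g 0%N = 0 ->
  \prod_(i <- r) conj_shift g D (d i) = conj_shift g D (\sum_(i <- r) d i).
Proof.
move=> g0; set K := row_operator g D.
have KK : K * K = 0 by exact: row_operator_sqr0.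
have UV : (1 + K) * (1 - K) = 1.
  by rewrite mulrBr mulr1 mulrDl mul1r KK addr0 addrK.
have VU : (1 - K) * (1 + K) = 1.
  by rewrite mulrDr mulr1 mulrBl mul1r KK subr0 subrK.
elim: r => [|i r IH]; first by rewrite !big_nil /conj_shift expr0 mulr1 UV.
rewrite !big_cons IH /conj_shift -/K exprD !mulrA; congr (_ * _ * _).
by rewrite -[LHS]mulrA VU mulr1.
Qed.

(** [1 - K] fixes the vacuum, the shifts move it to [basis d], and [1 + K] adds
[g d] times the vacuum. *)
Lemma conj_shift_vacuum g D d : g 0%N = 0 -> (d < D)%N ->
  vacuum_coef (conj_shift g D d (vacuum F)) = (d == 0)%N%:R + g d.
Proof.
move=> g0 dD; rewrite vacuumE /vacuum_coef vacuumE.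
rewrite (_ : conj_shift g D d (basis 0) = basis d + g d *: basis 0).
  by rewrite [LHS]dot_basis coordD coordZ !basisE mulr1 eq_sym.
change ((1 + row_operator g D : endo F)
  ((shift ^+ d) (basis 0 - row_operator g D (basis 0))) =
  basis d + g d *: basis 0).
rewrite row_operator_basis g0 if_same scale0r subr0 shiftX_basis addn0.
change (basis d + row_operator g D (basis d) = basis d + g d *: basis 0).
by rewrite row_operator_basis dD.
Qed.

Local Notation CA := (creation_annihilation_algebra (F := F)).

Lemma creation_annihilation_opp (T : endo F) : CA T -> CA (- T).
Proof. by rewrite -scaleN1r; exact: CAScale. Qed.

Lemma creation_annihilation0 : CA 0.
Proof. by rewrite -(scale0r (1 : endo F)); apply: CAScale; exact: CAOne. Qed.

Lemma creation_annihilation_exp (T : endo F) d : CA T -> CA (T ^+ d).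
Proof.
move=> CT; elim: d => [|d IH]; first by rewrite expr0; exact: CAOne.
by rewrite exprS; exact: CAMul.
Qed.

Lemma creation_annihilation_conj_shift g D d : CA (conj_shift g D d).
Proof.
have C1 : CA 1 by exact: CAOne.
have As : CA shift by apply: CALeftCreation; exact: left_creation_shift.
have Bs : CA backshift.
  apply: CALeftAnnihilation; first exact: left_creation_shift.
  exact: adjoint_shift.
have CK : CA (row_operator g D).
  apply: (big_ind CA); [exact: creation_annihilation0|exact: CAAdd|move=> k _].
  apply: CAScale; apply: CAMul; last exact: creation_annihilation_exp.
  by apply: CAAdd; [|apply: creation_annihilation_opp; exact: CAMul].
apply: CAMul; last by apply: CAAdd; last exact: creation_annihilation_opp.
by apply: CAMul; [exact: CAAdd|exact: creation_annihilation_exp].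
Qed.

End ConjugatedShifts.

Section DiagonalMatrices.
Context {R : realType} {H : hilbertSpace R} (F : fockSpace H) (n : nat).
Implicit Types (T : endo F) (w : side -> endo F).

Lemma left_matrix_scalar T (eta : mxmod F n) i j :
  left_matrix T%:M eta i j = T (eta i j).
Proof.
rewrite mxE (bigD1 i)//= mxE eqxx big1 ?addr0// => k.
by rewrite mxE eq_sym => /negPf ->.
Qed.

Lemma right_matrix_scalar T (eta : mxmod F n) i j :
  right_matrix T%:M eta i j = T (eta i j).
Proof.
rewrite mxE (bigD1 j)//= mxE eqxx big1 ?addr0// => k.
by rewrite mxE => /negPf ->.
Qed.

(** Left and right multiplication by a scalar matrix act in the same way on the
entries, so a word in them is the word in the scalars applied to each entry. *)
Lemma diagonal_word_entry w I (r : seq I) (chi : I -> side) (eta : mxmod F n)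
    i j :
  ((\prod_(k <- r) side_pair (left_matrix (w lft)%:M) (right_matrix (w rgt)%:M)
      (chi k)) eta : mxmod F n) i j =
  (\prod_(k <- r) w (chi k)) (eta i j).
Proof.
elim: r => [|k r IH]; rewrite ?big_nil// !big_cons /= -IH.
by case: (chi k); [exact: left_matrix_scalar|exact: right_matrix_scalar].
Qed.

Lemma vacuum_trace_diagonal_word w I (r : seq I) (chi : I -> side) :
  (0 < n)%N ->
  vacuum_trace F n (\prod_(k <- r)
    side_pair (left_matrix (w lft)%:M) (right_matrix (w rgt)%:M) (chi k)) =
  vacuum_coef ((\prod_(k <- r) w (chi k)) (vacuum F)).
Proof.
move=> n0; rewrite /vacuum_trace /mxtrace.
rewrite (eq_bigr (fun=> vacuum_coef ((\prod_(k <- r) w (chi k)) (vacuum F)))).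
rewrite sumr_const card_ord -[X in _ * X]mulr_natl mulKf//.
  by rewrite pnatr_eq0 -lt0n.
move=> i _; rewrite mxE diagonal_word_entry /vacuum_mx.
by rewrite mxE eqxx mulr1n.
Qed.

End DiagonalMatrices.

(** * Moments and cumulants that count letters *)

Section CountSums.
Context {K : comPzRingType}.
Implicit Types (c : nat -> nat -> K).
Local Open Scope nat_scope.

Definition count_lft m (chi : 'I_m -> side) := \sum_(i < m) is_lft (chi i).
Definition count_rgt m (chi : 'I_m -> side) := \sum_(i < m) ~~ is_lft (chi i).

Lemma count_sides m (chi : 'I_m -> side) : count_lft chi + count_rgt chi = m.
Proof.
rewrite -big_split /= -[RHS]card_ord -sum1_card.
by apply: eq_bigr => i _; case: is_lft.
Qed.

(** [s_chi] enumerates the left positions before the right ones. *)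
Lemma is_lft_s_chi m (chi : 'I_m -> side) (k : 'I_m) :
  is_lft (chi (s_chi chi k)) = (k < count_lft chi).
Proof.
have sz : size [seq i <- enum 'I_m | is_lft (chi i)] = count_lft chi.
  rewrite size_filter -sum1_count big_enum_cond big_mkcond /=.
  by apply: eq_bigr => i _; case: is_lft.
have szs : size (s_seq chi) = m.
  by rewrite (perm_size (s_seq_perm chi)) size_enum_ord.
rewrite /s_chi /s_seq nth_cat sz; case: ltnP => [kl|lk].
  have := mem_nth k (_ : k < size [seq i <- enum 'I_m | is_lft (chi i)]).
  by rewrite sz => /(_ kl); rewrite mem_filter => /andP[].
set s := rev _; have ks : k - count_lft chi < size s.
  by rewrite ltn_subLR// -sz -size_cat -/(s_seq chi) szs.
by have := mem_nth k ks; rewrite mem_rev mem_filter => /andP[/negPf].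
Qed.

Lemma count_subword (p : pred side) m (chi : 'I_m -> side) (V : {set 'I_m}) :
  \sum_(i < #|V|) p (subword chi i) = \sum_(i in V) p (chi i).
Proof. by rewrite [RHS]big_enum_val. Qed.

(** The moment of a word of length [m] with [p] left letters when the cumulants
depend only on the numbers of left and right letters; see [bnc_sum]. *)
Definition nc_sum c m p : K :=
  (\sum_(Q : {set {set 'I_m}} | noncrossing Q) \prod_(W in Q)
    c (\sum_(k in W) (k < p))%N (\sum_(k in W) (p <= k))%N)%R.

(** Transporting the blocks along [s_chi] turns the left positions into the
first ones, so nothing depends on the order of the letters any more. *)
Lemma bnc_sum c m (chi : 'I_m -> side) :
  (\sum_(P in bnc chi) \prod_(V in P)
     c (count_lft (subword (V:=V) chi)) (count_rgt (subword (V:=V) chi)))%R =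
  nc_sum c m (count_lft chi).
Proof.
have sI := @s_chi_inj _ chi.
rewrite /bnc big_imset /=; last first.
  by move=> P Q _ _; apply: imset_inj; exact: imset_inj.
apply: eq_big => [Q|Q _]; first by rewrite inE.
rewrite big_imset /=; last by move=> V W _ _; exact: (imset_inj sI).
apply: eq_bigr => W _; congr (c _ _).
  rewrite [LHS](count_subword is_lft) big_imset /=; last exact: in2W.
  by apply: eq_bigr => k _; rewrite is_lft_s_chi.
rewrite [LHS](count_subword (predC is_lft)) big_imset /=; last exact: in2W.
by apply: eq_bigr => k _; rewrite /= is_lft_s_chi -leqNgt.
Qed.

Lemma count_subwordT m (chi : 'I_m -> side) :
  (count_lft (subword (V:=[set: 'I_m]) chi) = count_lft chi) *
  (count_rgt (subword (V:=[set: 'I_m]) chi) = count_rgt chi).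
Proof.
split; first rewrite [LHS](count_subword is_lft);
  last rewrite [LHS](count_subword (predC is_lft));
  by apply: eq_bigl => i; rewrite inE.
Qed.

End CountSums.

Section CumulantsFromMoments.
Context {K : comPzRingType} {B : pzRingType} (psi : B -> K).

(** The recursion for the cumulants of a word involves only moments of words
that are not longer, and [bnc_sum] says that [c] satisfies it. *)
Lemma cumulant_of_moments (c : nat -> nat -> K) (Z : side -> B) N :
  (forall m (chi : 'I_m -> side), (0 < m <= N)%N ->
     psi (\prod_(i < m) Z (chi i)) = nc_sum c m (count_lft chi)) ->
  forall m (chi : 'I_m -> side), (0 < m <= N)%N ->
    bifree_cumulant psi chi (fun i => Z (chi i)) =
    c (count_lft chi) (count_rgt chi).
Proof.
move=> mom.
suff gen f m (chi : 'I_m -> side) : (0 < m <= N)%N -> (m <= f)%N ->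
    cumulant_rec psi f chi (fun i => Z (chi i)) =
    c (count_lft chi) (count_rgt chi).
  by move=> m chi mN; exact: gen.
elim: f m chi => [|f IH] m chi mN mf.
  by have /andP[m0 _] := mN; rewrite leqNgt m0 in mf.
have /andP[m0 leN] := mN.
rewrite /= mom// -bnc_sum (bigD1 _ (one_block_bnc chi m0)) /= big_set1.
rewrite !count_subwordT; apply/eqP; rewrite subr_eq addrC -subr_eq0 addrKA.
rewrite subr_eq0; apply/eqP.
apply: eq_bigr => P /andP[Pb PN]; apply: eq_bigr => V VP.
have /andP[V0 Vm] := bnc_block_card Pb PN VP.
apply/esym/IH; last by rewrite -ltnS (leq_trans Vm).
by rewrite V0 (leq_trans (ltnW Vm)).
Qed.

End CumulantsFromMoments.

(** * The model of the limit moments *)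

Section CommutingWords.
Context {K : pzRingType} (a1 a2 : K) (a12 : a1 * a2 = a2 * a1).

Lemma prod_side_pair m (chi : 'I_m -> side) :
  \prod_(i < m) side_pair a1 a2 (chi i) =
  a1 ^+ count_lft chi * a2 ^+ count_rgt chi.
Proof.
rewrite /count_lft /count_rgt.
apply: (big_rec3 (fun p q w => w = a1 ^+ p * a2 ^+ q)); first by rewrite mulr1.
move=> i p q w _ ->; case: (chi i) => /=.
  by rewrite add0n exprS mulrA.
rewrite add0n exprS !mulrA; congr (_ * _).
by apply: commrX; exact: esym.
Qed.

End CommutingWords.

Lemma count_lft_card m (chi : 'I_m -> side) :
  count_lft chi = #|[pred i | is_lft (chi i)]|.
Proof.
rewrite -sum1_card big_mkcond /=; apply: eq_bigr => i _.
by rewrite inE; case: is_lft.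
Qed.

Lemma count_rgt_card m (chi : 'I_m -> side) :
  count_rgt chi = #|[pred i | ~~ is_lft (chi i)]|.
Proof.
rewrite -sum1_card big_mkcond /=; apply: eq_bigr => i _.
by rewrite inE; case: is_lft.
Qed.

Section Model.
Context {R : realType} (M : nat -> nat -> R[i]) (M00 : M 0 0 = 1).
Local Notation F := (line_fock R).

(** The index of the word with [p] left and [q] right letters is
[q * N.+1 + p]; for [p, q <= N] it determines both. The value at [0] is set to
[0] because the coefficient of the vacuum in the vacuum is already
[M 0 0 = 1]. *)
Definition encoded_moment N k : R[i] :=
  if k == 0%N then 0 else M (k %% N.+1) (k %/ N.+1).

Definition moment_model N s : endo F :=
  conj_shift (encoded_moment N) (N.+1 * N.+1) (side_pair 1%N N.+1 s).

Lemma moment_model_trace n N m (chi : 'I_m -> side) : (0 < n)%N -> (m <= N)%N ->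
  vacuum_trace F n (\prod_(i < m)
    side_pair (left_matrix (moment_model N lft)%:M)
      (right_matrix (moment_model N rgt)%:M) (chi i)) =
  M (count_lft chi) (count_rgt chi).
Proof.
move=> n0 mN; rewrite vacuum_trace_diagonal_word//.
rewrite (@conj_shift_prod _ _ _ _ _ (fun i => side_pair 1%N N.+1 (chi i)))//.
set p := count_lft chi; set q := count_rgt chi.
have pqm : (p + q)%N = m := count_sides chi.
have -> : (\sum_(i < m) side_pair 1 N.+1 (chi i) = q * N.+1 + p)%N.
  rewrite /p /q big_distrl -big_split /=.
  apply: eq_bigr => i _.
  by case: (chi i) => /=; rewrite ?mul1n ?mul0n ?addn0 ?add0n.
have pN : (p < N.+1)%N by rewrite ltnS (leq_trans _ mN)// -pqm leq_addr.
have qN : (q < N.+1)%N by rewrite ltnS (leq_trans _ mN)// -pqm leq_addl.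
rewrite conj_shift_vacuum//; last first.
  by rewrite (leq_trans _ (leq_mul qN (leqnn N.+1)))// mulSn addnC ltn_add2r.
rewrite /encoded_moment addn_eq0 muln_eq0 orbF.
have [/andP[/eqP -> /eqP ->]|_] := ifP; first by rewrite addr0 M00.
by rewrite add0r modnMDl modn_small// divnMDl// divn_small// addn0.
Qed.

End Model.

Theorem theorem5p1 (R : realType) (lambda : R) (lambda_gt0 : 0 < lambda)
    (A : ncps R) (a1 a2 : A) (a12 : a1 * a2 = a2 * a1)
    (n : nat) (n_gt0 : (0 < n)%N) :
  let a := side_pair a1 a2 in
  exists (H : hilbertSpace R) (F : fockSpace H) (T S : nat -> 'M[endo F]_n),
    let Z N := side_pair (left_matrix (T N)) (right_matrix (S N)) in
    [/\ forall N i j, creation_annihilation_algebra (T N i j) /\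
                      creation_annihilation_algebra (S N i j),
        forall (C : ncps R) (z : side -> C),
          compound_bifree_poisson lambda a z ->
          cvg_in_distribution (vacuum_trace F n) Z z &
        forall m (chi : 'I_m -> side), (0 < m)%N ->
          ((fun N => bifree_cumulant (vacuum_trace F n) chi
                       (fun i => Z N (chi i)) : R[i]^o) @ \oo -->
            (lambda%:C * state A (\prod_(i < m) a (chi i)) : R[i]^o)) /\
          lambda%:C * state A (\prod_(i < m) a (chi i)) =
          lambda%:C * state A (a1 ^+ #|[pred i | is_lft (chi i)]| *
                               a2 ^+ #|[pred i | ~~ is_lft (chi i)]|)].
Proof.
move=> a.
pose c p q := lambda%:C * state A (a1 ^+ p * a2 ^+ q).
pose M p q : R[i] := if (p + q == 0)%N then 1 else nc_sum c (p + q) p.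
have cE m (chi : 'I_m -> side) :
    lambda%:C * state A (\prod_(i < m) a (chi i)) =
    c (count_lft chi) (count_rgt chi).
  by rewrite prod_side_pair.
have momE N m (chi : 'I_m -> side) : (m <= N)%N ->
    vacuum_trace (line_fock R) n (\prod_(i < m)
      side_pair (left_matrix (moment_model M N lft)%:M)
        (right_matrix (moment_model M N rgt)%:M) (chi i)) =
    if m == 0%N then 1 else nc_sum c m (count_lft chi).
  by move=> mN; rewrite moment_model_trace// /M count_sides.
exists (line_hilbert R), (line_fock R), (fun N => (moment_model M N lft)%:M),
  (fun N => (moment_model M N rgt)%:M) => Z.
split.
- move=> N i j; rewrite !mxE.
  by case: eqP => _; rewrite ?mulr1n ?mulr0n; split;
    do ?[exact: creation_annihilation_conj_shift|exact: creation_annihilation0].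
- move=> C z zP m chi; apply: cvg_near_cst; exists m => // N /= mN.
  rewrite momE//; have [m0|m0] := posnP m.
    by subst m; rewrite big_ord0 state1.
  rewrite (moment_cumulant _ chi)// -bnc_sum.
  apply: eq_bigr => P Pb; apply: eq_bigr => V VP.
  rewrite -cE; apply/esym/zP.
  by rewrite card_gt0 (partition_neq0 (bnc_partition Pb)).
- move=> m chi m0; split; last by rewrite cE count_lft_card count_rgt_card.
  apply: cvg_near_cst; exists m => // N /= mN.
  rewrite cE; apply: (@cumulant_of_moments _ _ _ c _ N); last by rewrite m0.
  by move=> k xi /andP[k0 kN]; rewrite momE// gtn_eqF.
Qed.
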